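(* Let $\phi \ge 0$. There is a gathering algorithm for two oblivious semi-synchronous robots with $\phi$-dynamic compasses only if $\phi<\pi/4$. Equivalently, if $\phi\ge\pi/4$, then for every total function $\psi:\mathbb{R}^2\to\mathbb{R}^2$ there exist an initial configuration and a fair semi-synchronous execution of $\psi$ by two robots with $\phi$-dynamic compasses starting from it that is not a gathering execution.
   Context: Robots. Two anonymous oblivious robots $r_0,r_1$ are points in $\mathbb{R}^2$, with position $\mathbf r_i(t)\in\mathbb{R}^2$ of $r_i$ at time $t$ in a global coordinate system $Z$. The configuration at time $t$ is $C(t)=(\mathbf r_0(t),\mathbf r_1(t))$. At time $t$ robot $r_i$ has a local coordinate system $Z_{(i,t)}$ given by $$Z_{(i,t)}(\mathbf p)^T = sc_i(t)\begin{pmatrix}\cos\phi_i(t)&\sin\phi_i(t)\\-\sin\phi_i(t)&\cos\phi_i(t)\end{pmatrix}(\mathbf p-\mathbf r_i(t))^T,$$ where the scaling ratio $sc_i(t)\in(0,\infty)$ and the compass deviation $\phi_i(t)\in(-\pi,\pi]$ are chosen by an adversary. (The scaling ratio may change from cycle to cycle.) Compasses. The compasses are $\phi$-dynamic if $|\phi_i(t)|\le\phi$ for $i\in\{0,1\}$ and all $t\in\mathbb{N}$ (where $0\in\mathbb N$); subject to this bound, $\phi_i(t)$ may change arbitrarily with $t$ from one cycle to the next (it is constant during a cycle). Algorithm and look-compute-move cycle. An algorithm is a total function $\psi:\mathbb{R}^2\to\mathbb{R}^2$, used by both robots. A robot $r_i$ activated at time $t\in\mathbb N$ observes the other robot $r_{1-i}$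 at local coordinates $\mathbf p=Z_{(i,t)}(\mathbf r_{1-i}(t))$, and then moves in a straight line from $\mathbf r_i(t)$ toward the point whose coordinates in $Z_{(i,t)}$ are $\psi(\mathbf p)$ (its destination). The adversary may stop the move before the destination is reached, but the robot either reaches its destination or travels a distance at least $\delta$ (measured in $Z$), where $\delta>0$ is a fixed constant. Semi-synchronous execution. At every $t\in\mathbb N$ the adversary activates a nonempty subset of the robots; each activated robot performs its whole cycle instantaneously in the sense that look and compute happen at $t$ and the move finishes before $t+1$; a non-activated robot does not move between $t$ and $t+1$. An execution is the resulting infinite sequence $C(0),C(1),\dots$; it is required to be fair: each robot is activated infinitely many times. Gathering. An execution is a gathering execution if there are $\mathbf p\in\mathbb{R}^2$ and $f\in\mathbb N$ with $C(t)=(\mathbf p,\mathbf p)$ for all $t\ge f$. An algorithm is a gathering algorithm if for every initial configuration $C(0)$, every execution starting from $C(0)$ is a gathering execution. *)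

(* Defs.v *)
From Stdlib Require Import Reals.
Open Scope R_scope.

Definition point : Type := (R * R)%type.

Definition dist (p q : point) : R :=
  dist_euc (fst p) (snd p) (fst q) (snd q).

Inductive robot : Type := r0 | r1.

Definition other (i : robot) : robot :=
  match i with r0 => r1 | r1 => r0 end.

Definition config : Type := (point * point)%type.

Definition pos (c : config) (i : robot) : point :=
  match i with r0 => fst c | r1 => snd c end.

(* Coordinates of [p] in the local system with origin [o], scaling ratio [sc]
   and compass deviation [a]: sc * [[cos a, sin a], [- sin a, cos a]] (p - o). *)
Definition local_coord (o : point) (sc a : R) (p : point) : point :=
  let x := fst p - fst o in
  let y := snd p - snd o in
  (sc * (cos a * x + sin a * y), sc * (- sin a * x + cos a * y)).

Definition on_segment (p q m : point) : Prop :=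
  exists s : R, 0 <= s <= 1 /\
    m = (fst p + s * (fst q - fst p), snd p + s * (snd q - snd p)).

(* One look-compute-move cycle of a robot at [p], with local system given by
   [sc] and [a], that sees the other robot at [q] and ends the cycle at [p'];
   [d] is its destination.  The distance [delta] is measured globally. *)
Definition cycle (delta : R) (psi : point -> point) (sc a : R)
    (p q p' : point) : Prop :=
  exists d : point,
    local_coord p sc a d = psi (local_coord p sc a q) /\
    on_segment p d p' /\
    (p' = d \/ delta <= dist p p').

(* The adversary's choices; [active i t] means that robot [i] is activated at
   time [t]. *)
Record adversary : Type := {
  active : robot -> nat -> Prop;
  scaling : robot -> nat -> R;
  deviation : robot -> nat -> R
}.

Definition legal_frames (adv : adversary) : Prop :=
  forall (i : robot) (t : nat),
    0 < scaling adv i t /\ - PI < deviation adv i t <= PI.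

Definition dynamic_compasses (phi : R) (adv : adversary) : Prop :=
  forall (i : robot) (t : nat), Rabs (deviation adv i t) <= phi.

Definition semi_synchronous (adv : adversary) : Prop :=
  forall t : nat, exists i : robot, active adv i t.

Definition fair (adv : adversary) : Prop :=
  forall (i : robot) (t : nat), exists t' : nat, (t <= t')%nat /\ active adv i t'.

Definition follows (delta : R) (psi : point -> point) (adv : adversary)
    (C : nat -> config) : Prop :=
  forall (i : robot) (t : nat),
    (active adv i t ->
       cycle delta psi (scaling adv i t) (deviation adv i t)
         (pos (C t) i) (pos (C t) (other i)) (pos (C (S t)) i)) /\
    (~ active adv i t -> pos (C (S t)) i = pos (C t) i).

Definition execution (phi delta : R) (psi : point -> point)
    (C : nat -> config) : Prop :=
  exists adv : adversary,
    legal_frames adv /\ dynamic_compasses phi adv /\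
    semi_synchronous adv /\ fair adv /\ follows delta psi adv C.

Definition gathering_execution (C : nat -> config) : Prop :=
  exists (p : point) (f : nat), forall t : nat, (f <= t)%nat -> C t = (p, p).

Definition gathering_algorithm (phi delta : R) (psi : point -> point) : Prop :=
  forall (C0 : config) (C : nat -> config),
    C 0%nat = C0 -> execution phi delta psi C -> gathering_execution C.

(* Main.v *)
(** If some pair of positions [p <> q] makes the robot at [p], with unit scaling
    and under every deviation of absolute value at most pi/4, move exactly onto
    [q], turn the segment by a quarter turn about [p].  From both ends of the
    turned segment the deviations pi/4 and -pi/4 reproduce the extreme views of
    the original pair, so both robots can be sent onto each other and swap
    forever.  If there is no such pair, activate the robots alternately, each
    time with a deviation whose destination is not the other robot. *)

Require Import Defs.
From Stdlib Require Import Reals Lra Lia Arith Classical ClassicalEpsilon.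
Open Scope R_scope.

(** The frame map is [sc] times a rotation, so its inverse is the transposed rotation divided by
    [sc]. Hence every value of [psi] names an actual destination. *)
Lemma local_coord_onto (o : point) (sc a : R) (w : point) :
  0 < sc -> exists d : point, local_coord o sc a d = w.
Proof.
  intros hsc; destruct o as [ox oy], w as [u v].
  exists (ox + (cos a * u - sin a * v) / sc, oy + (sin a * u + cos a * v) / sc).
  unfold local_coord; cbn [fst snd].
  pose proof (sin2_cos2 a) as h; unfold Rsqr in h.
  f_equal.
  - transitivity (u * (sin a * sin a + cos a * cos a)); [field; lra | rewrite h; ring].
  - transitivity (v * (sin a * sin a + cos a * cos a)); [field; lra | rewrite h; ring].
Qed.

(** Covers an adversary that never stops a move early: the segment parameter is 1. *)
Lemma cycle_reach (delta : R) (psi : point -> point) (sc a : R) (p q d : point) :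
  local_coord p sc a d = psi (local_coord p sc a q) ->
  cycle delta psi sc a p q d.
Proof.
  intros h; exists d; split; [exact h | split; [| now left]].
  exists 1; split; [lra |].
  destruct d; cbn [fst snd]; f_equal; ring.
Qed.

Lemma separated_not_gathering (C : nat -> config) :
  (forall t : nat, fst (C t) <> snd (C t)) -> ~ gathering_execution C.
Proof.
  intros hC [p [f h]]; apply (hC f); now rewrite (h f (le_n f)).
Qed.

Lemma legal_deviation (a : R) : Rabs a <= PI / 4 -> - PI < a <= PI.
Proof.
  intros h; pose proof PI_RGT_0.
  split_Rabs; lra.
Qed.

Definition turn (t : nat) : robot := if Nat.even t then r0 else r1.

Lemma turn_fair (i : robot) (t : nat) : exists t' : nat, (t <= t')%nat /\ i = turn t'.
Proof.
  unfold turn; destruct i; [exists (2 * t)%nat | exists (S (2 * t))];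
    (split; [lia |]).
  - now rewrite Nat.even_mul.
  - now rewrite Nat.even_succ, Nat.odd_mul.
Qed.

Definition relocate (i : robot) (p : point) (c : config) : config :=
  match i with r0 => (p, snd c) | r1 => (fst c, p) end.

(** [dest] takes the mover's position first and the observed one second. Destinations depend only on
    the current positions, so the trajectory is fixed first and the deviations are read off it
    afterwards. *)
Fixpoint alternate (dest : point -> point -> point) (c : config) (t : nat) : config :=
  match t with
  | O => c
  | S t => let C := alternate dest c t in
           relocate (turn t) (dest (Defs.pos C (turn t)) (Defs.pos C (other (turn t)))) C
  end.

(** Only one robot moves at a time, and it never lands on the one that stays. *)
Lemma alternate_separated (dest : point -> point -> point) (c : config) :
  fst c <> snd c -> (forall p q : point, p <> q -> dest p q <> q) ->
  forall t : nat, fst (alternate dest c t) <> snd (alternate dest c t).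
Proof.
  intros hc hdest t; induction t as [| t IH]; [exact hc |].
  cbn [alternate]; destruct (turn t); cbn.
  - now apply hdest.
  - apply not_eq_sym; apply hdest; now apply not_eq_sym.
Qed.

Lemma alternating_execution (phi delta : R) (psi : point -> point)
    (dev : point -> point -> R) (dest : point -> point -> point) (c : config) :
  PI / 4 <= phi -> fst c <> snd c ->
  (forall p q : point, Rabs (dev p q) <= PI / 4) ->
  (forall p q : point, p <> q ->
     local_coord p 1 (dev p q) (dest p q) = psi (local_coord p 1 (dev p q) q) /\
     dest p q <> q) ->
  execution phi delta psi (alternate dest c).
Proof.
  intros hphi hc hdev hdest.
  pose proof (alternate_separated dest c hc (fun p q h => proj2 (hdest p q h))) as hsep.
  exists {| active := fun i t => i = turn t;
            scaling := fun _ _ => 1;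
            deviation := fun i t => dev (Defs.pos (alternate dest c t) i)
                                        (Defs.pos (alternate dest c t) (other i)) |}.
  split; [| split; [| split; [| split]]].
  - intros i t; cbn; split; [lra | now apply legal_deviation].
  - intros i t; cbn; eapply Rle_trans; [apply hdev | exact hphi].
  - intros t; now exists (turn t).
  - intros i t; apply turn_fair.
  - intros i t; cbn [active scaling deviation alternate]; split.
    + intros ->.
      set (C := alternate dest c t) in *.
      replace (Defs.pos (relocate _ _ C) (turn t))
        with (dest (Defs.pos C (turn t)) (Defs.pos C (other (turn t))))
        by now destruct (turn t).
      apply cycle_reach, hdest.
      specialize (hsep t); fold C in hsep.
      destruct (turn t); cbn; [exact hsep | now apply not_eq_sym].
    + intros hi; destruct i, (turn t); cbn; congruence.
Qed.

Definition swapping (p q : point) (t : nat) : config :=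
  if Nat.even t then (p, q) else (q, p).

Lemma swapping_execution (phi delta : R) (psi : point -> point) (p q : point) (a b : R) :
  PI / 4 <= phi -> Rabs a <= PI / 4 -> Rabs b <= PI / 4 ->
  psi (local_coord p 1 a q) = local_coord p 1 a q ->
  psi (local_coord q 1 b p) = local_coord q 1 b p ->
  execution phi delta psi (swapping p q).
Proof.
  intros hphi ha hb hp hq.
  exists {| active := fun _ _ => True;
            scaling := fun _ _ => 1;
            (* Deviations belong to places: whichever robot stands at [p] uses [a], and the one at
               [q] uses [b]. At odd times the robots have exchanged places. *)
            deviation := fun i t => match i, Nat.even t with
                                    | r0, true | r1, false => a
                                    | _, _ => b
                                    end |}.
  split; [| split; [| split; [| split]]].
  - intros i t; cbn; split; [lra |].
    destruct i, (Nat.even t); now apply legal_deviation.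
  - intros i t; cbn; destruct i, (Nat.even t); lra.
  - intros t; now exists r0.
  - intros i t; now exists t.
  - intros i t; split; [intros _ | now intros []].
    unfold swapping; rewrite Nat.even_succ, <- Nat.negb_even.
    cbn [scaling deviation].
    destruct i, (Nat.even t); now apply cycle_reach.
Qed.

Definition quarter_turn (o p : point) : point :=
  (fst o - (snd p - snd o), snd o + (fst p - fst o)).

Lemma quarter_turn_neq (p q : point) : p <> q -> p <> quarter_turn p q.
Proof.
  destruct p as [x y], q as [u v]; unfold quarter_turn; cbn.
  intros hpq h; injection h as h1 h2; apply hpq; f_equal; lra.
Qed.

(** Target and frame both turn counterclockwise by pi/2, the frame from -pi/4 to pi/4, so the view
    is unchanged. *)
Lemma quarter_turn_view (p q : point) :
  local_coord p 1 (PI / 4) (quarter_turn p q) = local_coord p 1 (- (PI / 4)) q.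
Proof.
  unfold local_coord, quarter_turn; cbn [fst snd].
  rewrite cos_neg, sin_neg, cos_PI4, sin_PI4; f_equal; ring.
Qed.

(** Seen from the turned endpoint, [p] lies in the direction of [q - p] turned clockwise by pi/2;
    passing from pi/4 to -pi/4 turns the frame equally. *)
Lemma quarter_turn_view_back (p q : point) :
  local_coord (quarter_turn p q) 1 (- (PI / 4)) p = local_coord p 1 (PI / 4) q.
Proof.
  unfold local_coord, quarter_turn; cbn [fst snd].
  rewrite cos_neg, sin_neg, cos_PI4, sin_PI4; f_equal; ring.
Qed.

Lemma non_gathering_execution (phi delta : R) (psi : point -> point) :
  PI / 4 <= phi ->
  exists C : nat -> config, execution phi delta psi C /\ ~ gathering_execution C.
Proof.
  intros hphi; pose proof PI_RGT_0 as hPI.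
  destruct (classic (exists p q : point, p <> q /\
    forall (a : R) (d : point), Rabs a <= PI / 4 ->
      local_coord p 1 a d = psi (local_coord p 1 a q) -> d = q))
    as [(p & q & hpq & H) | H].
  (* [H] only constrains destinations that exist; surjectivity of the frame map supplies one, and
     its being [q] makes the view of [q] a fixed point of [psi]. *)
  - assert (hfix : forall a, Rabs a <= PI / 4 ->
              psi (local_coord p 1 a q) = local_coord p 1 a q).
    { intros a ha.
      destruct (local_coord_onto p 1 a (psi (local_coord p 1 a q))) as [d hd]; [lra |].
      now rewrite <- hd, (H a d ha hd). }
    assert (h1 : Rabs (PI / 4) <= PI / 4) by (apply Rabs_le; lra).
    assert (h2 : Rabs (- (PI / 4)) <= PI / 4) by (apply Rabs_le; lra).
    exists (swapping p (quarter_turn p q)); split.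
    + apply (swapping_execution _ _ _ _ _ (PI / 4) (- (PI / 4))); trivial.
      * rewrite quarter_turn_view; now apply hfix.
      * rewrite quarter_turn_view_back; now apply hfix.
    + apply separated_not_gathering; intros t.
      pose proof (quarter_turn_neq p q hpq).
      unfold swapping; destruct (Nat.even t); cbn; congruence.
  - assert (hchoice : forall p q : point, exists ad : R * point,
              Rabs (fst ad) <= PI / 4 /\
              (p <> q -> local_coord p 1 (fst ad) (snd ad)
                           = psi (local_coord p 1 (fst ad) q) /\ snd ad <> q)).
    { intros p q; apply NNPP; intros hn; apply H; exists p, q; split.
      (* For coincident positions [(0, p)] is a default value, which makes the choice below
         total. *)
      - intros hpq; apply hn; exists (0, p); cbn [fst snd]; split; [| easy].
        rewrite Rabs_R0; lra.
      - intros a d ha hd; apply NNPP; intros hdq; apply hn; now exists (a, d). }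
    (* Deviation and destination are chosen as one pair, so that they belong to the same cycle. *)
    pose (pick := fun p q => proj1_sig (constructive_indefinite_description _ (hchoice p q))).
    pose proof (fun p q =>
      proj2_sig (constructive_indefinite_description _ (hchoice p q))) as hpick.
    assert (hc : fst ((0, 0), (1, 0)) <> snd ((0, 0), (1, 0))).
    { cbn; intros h; injection h; lra. }
    exists (alternate (fun p q => snd (pick p q)) ((0, 0), (1, 0))); split.
    + apply alternating_execution with (dev := fun p q => fst (pick p q)); trivial;
        intros p q; apply hpick.
    + apply separated_not_gathering, alternate_separated; trivial.
      intros p q hpq; now apply hpick.
Qed.

Theorem theorem3 (phi delta : R) (hphi : 0 <= phi) (hdelta : 0 < delta) :
  ((exists psi : point -> point, gathering_algorithm phi delta psi) ->
     phi < PI / 4) /\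
  (PI / 4 <= phi ->
     forall psi : point -> point,
       exists (C0 : config) (C : nat -> config),
         C 0%nat = C0 /\ execution phi delta psi C /\ ~ gathering_execution C).
Proof.
  split.
  - intros [psi hpsi]; apply Rnot_le_lt; intros hle.
    destruct (non_gathering_execution phi delta psi hle) as (C & hC & hn).
    exact (hn (hpsi (C 0%nat) C eq_refl hC)).
  - intros hle psi.
    destruct (non_gathering_execution phi delta psi hle) as (C & hC & hn).
    now exists (C 0%nat), C.
Qed.
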